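(* Let $G$ be a finite simple graph with $n$ vertices and $m$ edges, and let $\lambda_1 \ge \cdots \ge \lambda_n$ be the eigenvalues of its Laplacian $L(G)$. If $k, l \in \{1,\ldots,n\}$ are such that $$\sum_{i=1}^k \lambda_i > m + \binom{k+1}{2} \quad\text{and}\quad \sum_{i=1}^l \lambda_i > m + \binom{l+1}{2},$$ then $$|l - k| < (2n)^{1/4}\max\{k,l\}^{1/2} < 2^{1/4} n^{3/4}.$$
   Context: The Laplacian is $L(G) = D(G) - A(G)$, with $A(G)$ the adjacency matrix and $D(G)$ the diagonal degree matrix. *)

(* Defs.v *)
From HB Require Import structures.
From mathcomp Require Import all_boot all_order all_algebra.
From mathcomp Require Import reals exp.

Set Implicit Arguments.
Unset Strict Implicit.
Unset Printing Implicit Defensive.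

Import Order.TTheory GRing.Theory Num.Theory.

Local Open Scope ring_scope.

(* A finite simple graph is a symmetric irreflexive relation e on a finType T;
   row and column i of its matrices stand for the vertex enum_val i. *)

Definition edges (T : finType) (e : rel T) : {set {set T}} :=
  [set [set p.1; p.2] | p : T * T & e p.1 p.2].

Definition degree (T : finType) (e : rel T) (x : T) : nat :=
  #|[set y | e x y]|.

Definition adjacency_mx (R : pzRingType) (T : finType) (e : rel T) :
    'M[R]_#|T| :=
  \matrix_(i, j) (e (enum_val i) (enum_val j))%:R.

Definition degree_mx (R : pzRingType) (T : finType) (e : rel T) :
    'M[R]_#|T| :=
  diag_mx (\row_i (degree e (enum_val i))%:R).

Definition laplacian_mx (R : pzRingType) (T : finType) (e : rel T) :
    'M[R]_#|T| :=
  degree_mx R e - adjacency_mx R e.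

(* lam lists the eigenvalues of M with algebraic multiplicity (which is the
   geometric one when M is real symmetric), in nonincreasing order. *)
Definition ordered_spectrum (R : realFieldType) (n : nat) (M : 'M[R]_n)
    (lam : n.-tuple R) : Prop :=
  sorted >=%R lam /\ char_poly M = \prod_(a <- lam) ('X - a%:P).

(* Main.v *)
(** Let [S_j] be the sum of the [j] largest Laplacian eigenvalues. The key fact
    is [S_j <= m + j (j + 1) / 2 + n / 4] for every [j].

    Take for [P] the projection onto the first [j] eigenvectors, omitting those
    of eigenvalue [0]; then [P 1 = 0] and, with [p_u = P_uu], summing over
    ordered adjacent pairs of vertices,
    [2 S_j - 2 m = sum_(u ~ v) (p_u + p_v - 1 - 2 P_uv)].
    Whether or not [u ~ v], AM-GM bounds the contribution of the pair by
    [p_u p_v - P_uv (p_u + p_v) + P_uv^2 / 2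
     + P_uv^2 (1 / (p_u (1 - p_u)) + 1 / (p_v (1 - p_v))) / 4],
    and all of these terms can be summed: [P 1 = 0] handles the linear one, and
    [sum_(v != u) P_uv^2 = p_u (1 - p_u)] turns the last one into [n / 2].

    If [k < l] both violate Brouwer's bound, concavity of [S] forces an excess
    of at least [(j - k) (l - j) / 2] at the midpoint [j], whence
    [(l - k)^2 < 2 n]; together with [l - k < l] this gives
    [(l - k)^4 < 2 n l^2]. *)

Require Import Defs.
From mathcomp Require Import all_boot all_order all_algebra all_fingroup.
From mathcomp Require Import reals exp.
From mathcomp Require Import complex ring lra zify.

Set Implicit Arguments.
Unset Strict Implicit.
Unset Printing Implicit Defensive.

Import Order.TTheory GRing.Theory Num.Theory.

Local Open Scope ring_scope.

(** * A trace inequality summed over pairs of vertices *)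

Lemma pair_ineq (R : realFieldType) (b : bool) (p q x : R) :
  0 < p < 1 -> 0 < q < 1 ->
  b%:R * (p + q - 1 - 2 * x) <=
    p * q - x * (p + q) + x ^+ 2 / 2
    + x ^+ 2 * ((p * (1 - p))^-1 + (q * (1 - q))^-1) / 4.
Proof.
(* For [c = s / t + t / s] the right-hand side is the square [(2 s t - y (s + t))^2] divided by
   [4 s t]. *)
have amgm (s t y c : R) : 0 < s < 1 -> 0 < t < 1 ->
    s / t + t / s <= c ->
    0 <= s * t - y * (s + t) + y ^+ 2 / 2 + y ^+ 2 * c / 4.
  move=> /andP[s0 s1] /andP[t0 t1] hc.
  have sn0 : s != 0 by rewrite gt_eqF.
  have tn0 : t != 0 by rewrite gt_eqF.
  have: 0 <= (2 * s * t - y * (s + t)) ^+ 2 / (4 * (s * t)).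
    by rewrite divr_ge0 ?sqr_ge0 // !mulr_ge0 ?ltW.
  have -> : (2 * s * t - y * (s + t)) ^+ 2 / (4 * (s * t)) =
     s * t - y * (s + t) + y ^+ 2 / 2 + y ^+ 2 * (s / t + t / s) / 4.
    by field; rewrite sn0 tn0.
  move=> h; apply: le_trans h _; rewrite lerD2l ler_pM2r ?invr_gt0 ?ltr0n //.
  by apply: ler_wpM2l => //; exact: sqr_ge0.
have ratio (s t : R) : 0 < s < 1 -> 0 < t < 1 -> s / t <= (t * (1 - t))^-1.
  move=> /andP[s0 s1] /andP[t0 t1].
  have u0 : 0 < t * (1 - t) by rewrite mulr_gt0 // subr_gt0.
  rewrite ler_pdivrMr // -(ler_pM2l u0) mulrA mulfV ?gt_eqF // mul1r.
  nra.
move=> p01 q01.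
have p01' : 0 < 1 - p < 1 by lra.
have q01' : 0 < 1 - q < 1 by lra.
case: b => /=; last first.
  rewrite mul0r; apply: amgm => //.
  by rewrite addrC; apply: lerD; apply: ratio.
(* When [b] holds, moving the left side over leaves the AM-GM form in [1 - p], [1 - q], [- x]; the
   sum of inverses is invariant under this substitution. *)
have -> : (p * (1 - p))^-1 + (q * (1 - q))^-1 =
    ((1 - p) * (1 - (1 - p)))^-1 + ((1 - q) * (1 - (1 - q)))^-1.
  by congr (_^-1 + _^-1); ring.
set D := _^-1 + _^-1.
have hD : (1 - p) / (1 - q) + (1 - q) / (1 - p) <= D.
  by rewrite addrC; apply: lerD; apply: ratio.
have := amgm _ _ (- x) _ p01' q01' hD; rewrite sqrrN mul1r; lra.
Qed.

Section TraceBound.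
Variables (R : realFieldType) (n : nat) (P : 'M[R]_n) (a : rel 'I_n).
Hypothesis a_irr : irreflexive a.
Hypothesis P_sym : P^T = P.
Hypothesis P_row0 : forall i, \sum_j P i j = 0.
Hypothesis P_contr : forall i, \sum_j P i j ^+ 2 <= P i i.

Let p i := P i i.

Let Psym i j : P i j = P j i.
Proof. by rewrite -{1}P_sym mxE. Qed.

Lemma contr_offdiag i : \sum_(j | j != i) P i j ^+ 2 <= p i * (1 - p i).
Proof.
have := P_contr i; rewrite (bigD1 i) //= -/(p i) => h.
by rewrite mulrBr mulr1 -expr2 lerBrDl.
Qed.

Lemma contr_var_ge0 i : 0 <= p i * (1 - p i).
Proof.
by apply: le_trans (contr_offdiag i); apply: sumr_ge0 => j _; exact: sqr_ge0.
Qed.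

Lemma contr_diag01 i : 0 <= p i <= 1.
Proof. have := contr_var_ge0 i; nra. Qed.

Lemma contr_offdiag_eq0 i j : j != i -> p i * (1 - p i) = 0 -> P i j = 0.
Proof.
move=> ji h; have := contr_offdiag i; rewrite h (bigD1 j) //= => h2.
apply/eqP; rewrite -sqrf_eq0 eq_le sqr_ge0 andbT.
apply: le_trans h2; rewrite lerDl; apply: sumr_ge0 => k _; exact: sqr_ge0.
Qed.

(** As [0^-1 = 0], the weight vanishes when [p i] is [0] or [1]; row [i] is then zero off the
    diagonal, so the degenerate rows cause no loss. *)
Let w i := (p i * (1 - p i))^-1.

Lemma contr_pair_ineq i j : j != i ->
  (a i j)%:R * (p i + p j - 1 - 2 * P i j) <=
  p i * p j - P i j * (p i + p j) + P i j ^+ 2 / 2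
  + P i j ^+ 2 * (w i + w j) / 4.
Proof.
move=> ji; have ij : i != j by rewrite eq_sym.
have /andP[pi0 pi1] := contr_diag01 i; have /andP[pj0 pj1] := contr_diag01 j.
(* If [P i j = 0], only [p i * p j >= 0] or [(1 - p i) * (1 - p j) >= 0] is at stake. Otherwise both
   diagonal entries lie strictly between [0] and [1]. *)
have [P0|Pn0] := eqVneq (P i j) 0.
  rewrite P0 expr0n /= !mul0r !mulr0 !addr0 subr0 subr0.
  by case: (a i j) => /=; nra.
have pos k : p k * (1 - p k) != 0 -> 0 < p k < 1.
  rewrite mulf_eq0 negb_or => /andP[h1 h2].
  have /andP[k0 k1] := contr_diag01 k.
  by rewrite !lt_def h1 k0 k1 -subr_eq0 h2.
apply: pair_ineq; apply: pos.
  by apply: contra_neq Pn0; exact: contr_offdiag_eq0.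
by apply: contra_neq Pn0; rewrite Psym; exact: contr_offdiag_eq0.
Qed.

Lemma contr_weight_sum i : \sum_(j | j != i) P i j ^+ 2 * w i <= 1.
Proof.
rewrite -mulr_suml; have [h|h] := eqVneq (p i * (1 - p i)) 0.
  by rewrite /w h invr0 mulr0 ler01.
rewrite ler_pdivrMr ?mul1r ?contr_offdiag // lt_def h; exact: contr_var_ge0.
Qed.

Lemma contr_offdiag_sum i : \sum_(j | j != i) P i j = - p i.
Proof.
apply/eqP; rewrite -addr_eq0 addrC -[X in _ == X](P_row0 i).
by rewrite [eqbRHS](bigD1 i).
Qed.

Lemma trace_bound :
  \sum_i \sum_j (a i j)%:R * (P i i + P j j - 1 - 2 * P i j) <=
  \tr P ^+ 2 + \tr P + n%:R / 2.
Proof.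
have t_def : \tr P = \sum_i p i by [].
pose F i j := p i * p j - P i j * (p i + p j) + P i j ^+ 2 / 2
  + P i j ^+ 2 * (w i + w j) / 4.
have le1 : \sum_i \sum_j (a i j)%:R * (P i i + P j j - 1 - 2 * P i j) <=
    \sum_i \sum_(j | j != i) F i j.
  apply: ler_sum => i _; rewrite (bigD1 i) //= a_irr mul0r add0r.
  by apply: ler_sum => j ji; exact: contr_pair_ineq.
apply: (le_trans le1).
have swap (G : 'I_n -> 'I_n -> R) : \sum_i \sum_(j | j != i) G i j =
    \sum_i \sum_(j | j != i) G j i.
  rewrite (exchange_big_dep predT) //=; apply: eq_bigr => i _.
  by apply: eq_bigl => j; rewrite eq_sym.
(* By symmetry of [P], sums that differ by exchanging [i] and [j] agree: the linear term doubles and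
   the weight [1/4] becomes [1/2]. *)
have -> : \sum_i \sum_(j | j != i) F i j =
    \sum_i \sum_(j | j != i) p i * p j
    - 2 * (\sum_i \sum_(j | j != i) P i j * p i)
    + (\sum_i \sum_(j | j != i) P i j ^+ 2) / 2
    + (\sum_i \sum_(j | j != i) P i j ^+ 2 * w i) / 2.
  have e1 : \sum_i \sum_(j | j != i) P i j * p j =
      \sum_i \sum_(j | j != i) P i j * p i.
    rewrite swap; apply: eq_bigr => i _; apply: eq_bigr => j _.
    by rewrite (Psym j i).
  have e2 : \sum_i \sum_(j | j != i) P i j ^+ 2 * w j =
      \sum_i \sum_(j | j != i) P i j ^+ 2 * w i.
    rewrite swap; apply: eq_bigr => i _; apply: eq_bigr => j _.
    by rewrite (Psym j i).
  have -> : \sum_i \sum_(j | j != i) F i j =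
    \sum_i \sum_(j | j != i) p i * p j
    - (\sum_i \sum_(j | j != i) P i j * p i
       + \sum_i \sum_(j | j != i) P i j * p j)
    + (\sum_i \sum_(j | j != i) P i j ^+ 2) / 2
    + (\sum_i \sum_(j | j != i) P i j ^+ 2 * w i
       + \sum_i \sum_(j | j != i) P i j ^+ 2 * w j) / 4.
    rewrite -!big_split /= !mulr_suml -sumrB -!big_split /=.
    apply: eq_bigr => i _.
    rewrite -!big_split /= !mulr_suml -sumrB -!big_split /=.
    by apply: eq_bigr => j _; rewrite /F -mulrDr -mulrDr.
  by rewrite e1 e2; field.
have E1 : \sum_i \sum_(j | j != i) p i * p j = \tr P ^+ 2 - \sum_i p i ^+ 2.
  rewrite expr2 t_def mulr_suml -sumrB; apply: eq_bigr => i _.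
  by rewrite mulr_sumr [in RHS](bigD1 i) //= expr2 addrC addrK.
have E2 : \sum_i \sum_(j | j != i) P i j * p i = - \sum_i p i ^+ 2.
  rewrite -sumrN; apply: eq_bigr => i _.
  by rewrite -mulr_suml contr_offdiag_sum mulNr expr2.
have E3 : \sum_i \sum_(j | j != i) P i j ^+ 2 <= \tr P - \sum_i p i ^+ 2.
  rewrite t_def -sumrB; apply: ler_sum => i _.
  by apply: le_trans (contr_offdiag i) _; rewrite mulrBr mulr1 expr2.
have E4 : \sum_i \sum_(j | j != i) P i j ^+ 2 * w i <= n%:R.
  rewrite -[X in X%:R](card_ord n) -sumr_const.
  by apply: ler_sum => i _; exact: contr_weight_sum.
have E5 : \sum_i p i ^+ 2 <= \tr P.
  rewrite t_def; apply: ler_sum => i _; have := contr_diag01 i; nra.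
(* With [Q] the sum of the [p i ^+ 2] and [t = \tr P], the total is at most
   [t^2 - Q + 2 Q + (t - Q) / 2 + n / 2], and [Q <= t] finishes. *)
rewrite E1 E2; move: (\sum_i \sum_(j | j != i) P i j ^+ 2) E3 => X3 E3.
move: (\sum_i \sum_(j | j != i) P i j ^+ 2 * w i) E4 => X4 E4.
move: (\sum_i p i ^+ 2) E5 E3 => Q E5 E3; lra.
Qed.

End TraceBound.

(** * Spectral projections of real symmetric matrices *)

Lemma char_poly_similar (F : fieldType) n (A B U : 'M[F]_n) :
  U \in unitmx -> U *m A = B *m U -> char_poly A = char_poly B.
Proof.
move=> Uu UA; pose UX := map_mx (@polyC F) U.
have UXn0 : \det UX != 0.
  by rewrite det_map_mx polyC_eq0 -unitfE -unitmxE.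
apply: (mulfI UXn0); rewrite [RHS]mulrC -!det_mulmx /char_poly_mx.
by rewrite mulmxBr mulmxBl scalar_mxC /UX -!map_mxM UA.
Qed.

Section SpectralProjection.
Local Open Scope complex_scope.
Local Open Scope sesquilinear_scope.

(** The spectral theorem yields the eigenvalues in an unspecified order. Both lists are the roots of
    one characteristic polynomial, so a permutation of the rows of the unitary matrix puts them in
    the order of [lam]. *)
Lemma spectral_real_sym (R : rcfType) n (A : 'M[R]_n) (lam : n.-tuple R) :
  A^T = A -> char_poly A = \prod_(c <- lam) ('X - c%:P) ->
  exists2 V : 'M[R[i]]_n, V \is unitarymx &
    V *m map_mx (real_complex R) A =
    diag_mx (\row_i (tnth lam i)%:C) *m V.
Proof.
move=> Asym Achar; set A' := map_mx _ A.
have A'sym : A' \is symmetricmx.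
  by apply/is_hermitianmxP; rewrite expr0 scale1r map_mx_id // map_trmx Asym.
have A'real : A' \is a mxOver Num.real.
  by apply/mxOverP => i j; rewrite !mxE complex_real.
have /hermitian_normalmx/orthomx_spectralP := realsym_hermsym A'sym A'real.
set U := spectralmx A'; set d := spectral_diag A' => A'E.
have Uunitary : U \is unitarymx := spectral_unitarymx A'.
have Uunit := unitarymx_unit Uunitary.
have UA : U *m A' = diag_mx d *m U by rewrite A'E !mulmxA mulmxV // mul1mx.
have d_lam : perm_eq [seq x%:C | x <- lam] [tuple d 0 i | i < n].
  apply: prod_XsubC_eq; rewrite big_map.
  have -> : \prod_(j <- lam) ('X - (j%:C)%:P) = char_poly A'.
    rewrite -map_char_poly Achar rmorph_prod; apply: eq_bigr => x _.
    by rewrite rmorphB /= map_polyX map_polyC.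
  rewrite (char_poly_similar Uunit UA) char_poly_trig ?diag_mx_is_trig //.
  rewrite big_map big_enum /=; apply: eq_bigr => i _.
  by rewrite mxE eqxx mulr1n.
have /tuple_permP[s s_lam] := d_lam.
have lamE i : (tnth lam i)%:C = d 0 (s i).
  have := congr1 (nth 0 ^~ i) s_lam.
  rewrite (nth_map 0) ?size_tuple // -!tnth_nth !tnth_mktuple => <-.
  by rewrite (tnth_nth 0).
exists (row_perm s U).
  apply/unitarymxP; rewrite row_permE trmx_mul map_mxM mulmxA.
  rewrite -(mulmxA (perm_mx s)) (unitarymxP Uunitary) mulmx1.
  by rewrite tr_perm_mx map_perm_mx -perm_mxM mulgV perm_mx1.
apply/matrixP => i j; rewrite mul_diag_mx !mxE lamE.
have /matrixP/(_ (s i) j) := UA; rewrite mul_diag_mx !mxE => <-.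
by apply: eq_bigr => k _; rewrite !mxE.
Qed.

(* On [R[i]] seen as [Rcomplex R] the real part has its additive structure. *)
Local Notation reC := (@complex.Re _ : Rcomplex _ -> _).

(* The eigenvectors are complex, so [P] is the real part of the projection they
   define; it is no longer idempotent, but the inequality on its rows, which is
   all that is used of idempotence, survives. *)
Lemma spectral_projection (R : rcfType) n (A : 'M[R]_n) (lam : n.-tuple R)
    (I : pred 'I_n) :
  A^T = A -> char_poly A = \prod_(c <- lam) ('X - c%:P) ->
  {in I, forall i, tnth lam i != 0} ->
  exists P : 'M[R]_n,
    [/\ P^T = P, forall i, \sum_j P i j ^+ 2 <= P i i, \tr P = #|I|%:R,
        \tr (P *m A) = \sum_(i in I) tnth lam i
      & forall x : 'cV_n, A *m x = 0 -> P *m x = 0].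
Proof.
move=> Asym Achar lam_n0.
have [V Vu VA] := spectral_real_sym Asym Achar.
pose toC := real_complex R.
pose X : 'M[R[i]]_n := diag_mx (\row_i (i \in I)%:R).
pose Q := V^t* *m X *m V.
have VV : V *m V^t* = 1%:M by apply/unitarymxP.
have XX : X *m X = X.
  by apply/matrixP => i j; rewrite mul_diag_mx !mxE mulrnAr -natrM mulnb andbb.
have QQ : Q *m Q = Q.
  by rewrite /Q -!mulmxA (mulmxA V) VV mul1mx (mulmxA X) XX.
have Qh : Q^t* = Q.
  rewrite /Q !trmx_mul !map_mxM !mulmxA trmxCK; congr (_ *m _ *m _).
  rewrite tr_diag_mx map_diag_mx; congr diag_mx; apply/rowP => i.
  by rewrite !mxE rmorph_nat.
have Qconj i j : Q j i = (Q i j)^*%C by rewrite -{1}Qh !mxE.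
pose P := map_mx reC Q.
have PE i j : P i j = complex.Re (Q i j) by rewrite mxE.
have ReM (x : R) (z : R[i]) : complex.Re (z * toC x) = complex.Re z * x.
  by case: z => a b /=; rewrite mulr0 subr0.
have PM m (B : 'M[R]_(n, m)) i j :
    (P *m B) i j = complex.Re ((Q *m map_mx toC B) i j).
  rewrite !mxE (raddf_sum reC); apply: eq_bigr => k _.
  by rewrite !mxE [RHS]ReM.
exists P; split.
- by apply/matrixP => i j; rewrite [LHS]mxE !PE Qconj; case: (Q i j).
(* [Q] is a Hermitian idempotent, so [Q i i] is the sum of the squared moduli in row [i], and each
   modulus dominates the real part. *)
- move=> i; rewrite PE -QQ mxE (raddf_sum reC).
  apply: ler_sum => j _; rewrite PE (Qconj i j); case: (Q i j) => a b /=.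
  by rewrite mulrN opprK expr2 lerDl -expr2 sqr_ge0.
- transitivity (complex.Re (\tr Q)).
    by rewrite /mxtrace (raddf_sum reC); apply: eq_bigr => i _; rewrite PE.
  rewrite /Q mxtrace_mulC mulmxA VV mul1mx mxtrace_diag.
  under eq_bigr do rewrite mxE.
  rewrite (raddf_sum reC) -sum1_card natr_sum.
  by rewrite [RHS]big_mkcond; apply: eq_bigr => i _; case: (i \in I).
- transitivity (complex.Re (\tr (Q *m map_mx toC A))).
    by rewrite /mxtrace (raddf_sum reC); apply: eq_bigr => i _; rewrite PM.
  rewrite /Q -(mulmxA _ V) VA mulmxA mxtrace_mulC !mulmxA VV mul1mx.
  rewrite /mxtrace (raddf_sum reC).
  rewrite [RHS]big_mkcond; apply: eq_bigr => i _; rewrite mul_diag_mx !mxE eqxx.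
  by case: (i \in I); rewrite ?mul1r ?mul0r.
(* In eigencoordinates, a kernel vector of [A] is supported on zero eigenvalues, whereas [X] retains
   only nonzero ones. *)
- move=> x Ax; apply/matrixP => i j; rewrite PM.
  suff -> : Q *m map_mx toC x = 0 by rewrite !mxE.
  rewrite /Q -!mulmxA; set y := V *m _; suff -> : X *m y = 0 by rewrite mulmx0.
  have : diag_mx (\row_i (tnth lam i)%:C) *m y = 0.
    by rewrite /y mulmxA -VA -mulmxA -map_mxM Ax map_mx0 mulmx0.
  move=> /matrixP Dy; apply/matrixP => k l; have := Dy k l.
  rewrite !mul_diag_mx !mxE.
  case: (boolP (k \in I)) => [kI /eqP|]; last by rewrite mul0r.
  rewrite mulf_eq0 => /orP[|/eqP->]; last by rewrite mulr0.
  by rewrite (fmorph_eq0 toC) (negPf (lam_n0 _ kI)).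
Qed.
End SpectralProjection.

(** * The graph Laplacian and the bound on its partial eigenvalue sums *)

Lemma sum_rel_edges (T : finType) (e : rel T) :
  symmetric e -> irreflexive e ->
  (\sum_x \sum_y e x y = 2 * #|edges e|)%N.
Proof.
move=> e_sym e_irr.
pose D := [set p : T * T | e p.1 p.2].
have -> : (\sum_x \sum_y e x y = #|D|)%N.
  rewrite pair_big /= -sum1_card [RHS]big_mkcond /=.
  by apply: eq_bigr => p _; rewrite inE; case: (e _ _).
rewrite -sum1_card.
have eE : edges e = [set [set p.1; p.2] | p in D].
  apply/setP => E; apply/imsetP/imsetP => -[p]; rewrite inE => ep ->;
    by exists p; rewrite ?inE.
(* Ordered adjacent pairs are grouped by their underlying edge; irreflexivity gives each group
   exactly two members. *)
rewrite (partition_big_imset (fun p : T * T => [set p.1; p.2])) -eE /=.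
rewrite mulnC -sum_nat_const; apply: eq_bigr => E.
rewrite eE => /imsetP[[x y]]; rewrite inE /= => exy ->.
have nxy : x != y by apply: contraTneq exy => ->; rewrite e_irr.
rewrite sum1dep_card.
have -> : [set p | (p \in D) && ([set p.1; p.2] == [set x; y])] =
    [set (x, y); (y, x)].
  apply/setP => -[u v]; rewrite !inE /= !xpair_eqE; apply/andP/orP.
    move=> [euv /eqP/setP h].
    have nuv : u != v by apply: contraTneq euv => ->; rewrite e_irr.
    have := h u; have := h v; rewrite !inE !eqxx orbT /=.
    move=> /esym/orP[]/eqP vE /esym/orP[]/eqP uE; subst u v.
    + by rewrite eqxx in nuv.
    + by right; rewrite !eqxx.
    + by left; rewrite !eqxx.
    + by rewrite eqxx in nuv.
  move=> [/andP[/eqP-> /eqP->]|/andP[/eqP-> /eqP->]]; first by rewrite exy eqxx.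
  by rewrite e_sym exy setUC eqxx.
by rewrite cards2 xpair_eqE (negPf nxy).
Qed.

Section Laplacian.
Variables (R : rcfType) (T : finType) (e : rel T).
Hypotheses (e_sym : symmetric e) (e_irr : irreflexive e).

Let n := #|T|.
Let m := #|edges e|.
Let L := laplacian_mx R e.
Let a : rel 'I_n := fun i j => e (enum_val i) (enum_val j).

Let sum_enum (F : T -> nat) : (\sum_x F x = \sum_(i < n) F (enum_val i))%N.
Proof. by rewrite (reindex (@enum_val T T)) //; exact/onW_bij/enum_val_bij. Qed.

Let degreeE i : (degree e (enum_val i))%:R = \sum_j (a i j)%:R :> R.
Proof.
rewrite -natr_sum /degree -sum1dep_card big_mkcond /= sum_enum.
by congr (_%:R); apply: eq_bigr => j _; rewrite /a; case: (e _ _).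
Qed.

Lemma adjacency_sum : \sum_i \sum_j (a i j)%:R = 2 * m%:R :> R.
Proof.
rewrite -natrM -sum_rel_edges // sum_enum natr_sum; apply: eq_bigr => i _.
by rewrite sum_enum natr_sum.
Qed.

Lemma laplacian_sym : L^T = L.
Proof.
rewrite /L /laplacian_mx linearB /= tr_diag_mx; congr (_ - _).
by apply/matrixP => i j; rewrite !mxE e_sym.
Qed.

Let laplacianE i j : L i j = (\sum_k (a i k)%:R) *+ (i == j) - (a i j)%:R.
Proof. by rewrite !mxE degreeE. Qed.

Lemma laplacian_const1 : L *m const_mx 1 = 0 :> 'cV_n.
Proof.
apply/matrixP => i j; rewrite [LHS]mxE [RHS]mxE.
under eq_bigr => k _ do rewrite laplacianE [const_mx _ _ _]mxE mulr1.
rewrite sumrB (bigD1 i) //= eqxx mulr1n.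
rewrite [X in _ + X - _]big1 ?addr0 ?subrr // => k.
by rewrite eq_sym => /negPf->.
Qed.

Lemma mxtrace_laplacian : \tr L = 2 * m%:R.
Proof.
rewrite /mxtrace -adjacency_sum; apply: eq_bigr => i _.
by rewrite laplacianE eqxx mulr1n /a e_irr subr0.
Qed.

(** Expanding [L] as degrees minus adjacency, the [P i i] and [P j j] sums agree because [e] is
    symmetric, and the [- 1] contributes [- 2 m]. *)
Lemma mxtrace_mul_laplacian (P : 'M[R]_n) : P^T = P ->
  \sum_i \sum_j (a i j)%:R * (P i i + P j j - 1 - 2 * P i j) =
  2 * \tr (P *m L) - 2 * m%:R.
Proof.
move=> Psym.
have trE : \tr (P *m L) =
    \sum_i \sum_j (a i j)%:R * P i i - \sum_i \sum_j (a i j)%:R * P i j.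
  rewrite -sumrB; apply: eq_bigr => i _; rewrite mxE.
  under eq_bigr => j _ do rewrite -laplacian_sym [L^T _ _]mxE laplacianE mulrBr.
  rewrite sumrB (bigD1 i) //= eqxx mulr1n.
  rewrite [X in _ + X - _]big1 ?addr0; last first.
    by move=> k /negPf; rewrite eq_sym => ->; rewrite mulr0.
  rewrite mulr_sumr; congr (_ - _); apply: eq_bigr => j _; exact: mulrC.
have swap : \sum_i \sum_j (a i j)%:R * P j j = \sum_i \sum_j (a i j)%:R * P i i.
  rewrite exchange_big; apply: eq_bigr => i _; apply: eq_bigr => j _.
  by rewrite /a e_sym.
transitivity (\sum_i \sum_j (a i j)%:R * P i i
    + \sum_i \sum_j (a i j)%:R * P j j - \sum_i \sum_j (a i j)%:R
    - 2 * (\sum_i \sum_j (a i j)%:R * P i j)); last first.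
  by rewrite swap adjacency_sum trE; ring.
rewrite mulr_sumr -big_split -!sumrB /=; apply: eq_bigr => i _.
by rewrite mulr_sumr -big_split -!sumrB /=; apply: eq_bigr => j _; ring.
Qed.

Lemma laplacian_partial_sum (lam : n.-tuple R) (j : nat) :
  char_poly L = \prod_(c <- lam) ('X - c%:P) -> (j <= n)%N ->
  \sum_(i < j) lam`_i <= m%:R + j%:R * (j%:R + 1) / 2 + n%:R / 4.
Proof.
move=> Lchar jn.
pose I := [pred i : 'I_n | (i < j)%N && (tnth lam i != 0)].
have In0 : {in I, forall i, tnth lam i != 0} by move=> i /andP[].
have [P [Psym Pcontr Ptr PL Pker]] :=
  spectral_projection laplacian_sym Lchar In0.
have Prow i : \sum_k P i k = 0.
  have /matrixP/(_ i 0) := Pker _ laplacian_const1; rewrite !mxE => {2}<-.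
  by apply: eq_bigr => k _; rewrite mxE mulr1.
have := trace_bound (a := a) _ Psym Prow Pcontr.
have a_irr : irreflexive a by move=> i; rewrite /a e_irr.
move=> /(_ a_irr); rewrite mxtrace_mul_laplacian // PL Ptr.
have -> : \sum_(i in I) tnth lam i = \sum_(i < j) lam`_i.
  rewrite (big_ord_widen n (fun i => lam`_i) jn).
  rewrite [RHS](bigID (fun i : 'I_n => tnth lam i == 0)) /=.
  rewrite [X in X + _]big1 ?add0r => [|i /andP[_ /eqP]]; last first.
    by rewrite (tnth_nth 0).
  by apply: eq_bigr => i _; rewrite (tnth_nth 0).
(* Discarding zero eigenvalues may leave fewer than [j] indices; [t (t + 1)] is increasing for
   [t >= 0], so the bound for [#|I|] implies the one for [j]. *)
have tj : #|I|%:R <= j%:R :> R.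
  rewrite ler_nat; apply: (@leq_trans (\sum_(i < j) 1)); last first.
    by rewrite sum1_card card_ord.
  rewrite (big_ord_widen n (fun=> 1%N) jn) sum1dep_card.
  by apply/subset_leq_card/subsetP => i /andP[ij _]; rewrite inE.
have t0 : 0 <= #|I|%:R :> R by rewrite ler0n.
move: (\sum_(i < j) _) (#|I|%:R) tj t0 => S t tj t0; nra.
Qed.

End Laplacian.

(** * Concavity of partial sums and the indices violating Brouwer's bound *)

Lemma sorted_partial_sum_concave (R : realFieldType) (s : seq R) (k j l : nat) :
  sorted >=%R s -> (k <= j < l)%N -> (l <= size s)%N ->
  (l%:R - j%:R) * (\sum_(i < k) s`_i) + (j%:R - k%:R) * (\sum_(i < l) s`_i) <=
  (l%:R - k%:R) * (\sum_(i < j) s`_i).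
Proof.
move=> s_sorted /andP[kj jl] ls.
have mono i1 i2 : (i1 <= i2)%N -> (i2 < size s)%N -> s`_i2 <= s`_i1.
  move=> h1 h2; apply: (sorted_leq_nth ge_trans ge_refl 0 s_sorted) => //.
  by rewrite inE; exact: leq_ltn_trans h1 h2.
rewrite -!(big_mkord xpredT (fun i => s`_i)).
rewrite (big_cat_nat (leq0n k) kj) (big_cat_nat (leq0n j) (ltnW jl)).
rewrite (big_cat_nat (leq0n k) kj) /=.
(* The entry at [j] is the pivot: earlier terms are at least it, terms from [j] on at most it. *)
have lo : (j%:R - k%:R) * s`_j <= \sum_(k <= i < j) s`_i.
  rewrite -natrB // mulr_natl -sumr_const_nat !big_nat; apply: ler_sum => i.
  by move=> /andP[_ ij]; apply: mono; [exact: ltnW | exact: leq_trans jl ls].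
have hi : \sum_(j <= i < l) s`_i <= (l%:R - j%:R) * s`_j.
  rewrite -natrB ?(ltnW jl) // mulr_natl -sumr_const_nat !big_nat.
  apply: ler_sum => i /andP[ji il]; apply: mono => //; exact: leq_trans il ls.
have kj' : k%:R <= j%:R :> R by rewrite ler_nat.
have jl' : j%:R <= l%:R :> R by rewrite ler_nat ltnW.
move: (\sum_(0 <= i < k) _) (\sum_(k <= i < j) _) (\sum_(j <= i < l) _) lo hi.
by move=> A B C lo hi; nra.
Qed.

Lemma natr_binS2 (R : realFieldType) (k : nat) :
  'C(k.+1, 2)%:R = k%:R * (k%:R + 1) / 2 :> R.
Proof.
have := congr1 (fun t => t%:R : R) (mul_bin_diag k.+1 1).
by rewrite /= bin1 !natrM -natr1; lra.
Qed.

Section Violation.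
Variables (R : rcfType) (T : finType) (e : rel T) (lam : #|T|.-tuple R).
Hypotheses (e_sym : symmetric e) (e_irr : irreflexive e).
Hypothesis lam_spec : ordered_spectrum (laplacian_mx R e) lam.

Let n := #|T|.

(** The failure of Brouwer's inequality at index [k]. *)
Definition violates (k : nat) : Prop :=
  #|edges e|%:R + 'C(k.+1, 2)%:R < \sum_(i < k) lam`_i.

(** At [k = n] the sum is the trace [2 m], so a violation would need [m > n (n + 1) / 2],
    contradicting [2 m <= n^2]. *)
Lemma violates_lt (k : nat) : (1 <= k <= n)%N -> violates k -> (k < n)%N.
Proof.
move=> /andP[k0 kn] Vk; rewrite ltn_neqAle kn andbT; apply/eqP => kE.
move: Vk; rewrite /violates natr_binS2.
have -> : \sum_(i < k) lam`_i = 2 * #|edges e|%:R.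
  have [_ Lchar] := lam_spec.
  have n0 : (0 < #|T|)%N by rewrite -/n -kE.
  (* Trace and sum of roots are both minus the coefficient of degree [n - 1]. *)
  rewrite -mxtrace_laplacian // -[RHS]opprK -(char_poly_trace _ n0) Lchar.
  rewrite -{3}(size_tuple lam) coefPn_prod_XsubC ?size_tuple -?lt0n // opprK.
  by rewrite (big_nth 0) size_tuple big_mkord kE.
have : (2 * #|edges e| <= n * n)%N.
  rewrite -sum_rel_edges // -sum_nat_const; apply: leq_sum => x _.
  rewrite -[n]muln1 -sum_nat_const; apply: leq_sum => y _; exact: leq_b1.
rewrite -(ler_nat R) !natrM kE => h1 h2.
have : 0 <= n%:R :> R by rewrite ler0n.
move: n%:R h1 h2 => {kE} N h1 h2 N0; lra.
Qed.

Lemma violates_close (k l : nat) : (k < l <= n)%N ->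
  violates k -> violates l -> ((l - k) ^ 2 < 2 * n)%N.
Proof.
move=> /andP[kl ln] Vk Vl; pose j := (k + (l - k)./2)%N.
have kjl : (k <= j < l)%N by rewrite /j; lia.
have [lam_sorted Lchar] := lam_spec.
have ls : (l <= size lam)%N by rewrite size_tuple.
have conc := sorted_partial_sum_concave lam_sorted kjl ls.
have jn : (j <= #|T|)%N by rewrite -/n; lia.
have := laplacian_partial_sum e_sym e_irr Lchar jn.
move: Vk Vl; rewrite /violates !natr_binS2.
move: kjl => /andP[kj jl].
have kj' : k%:R <= j%:R :> R by rewrite ler_nat.
have jl' : j%:R < l%:R :> R by rewrite ltr_nat.
move=> Vk Vl Bj.
have : 2 * (j%:R - k%:R) * (l%:R - j%:R) < n%:R :> R.
  move: Vk Vl Bj conc kj' jl'; rewrite -/n.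
  move: (\sum_(i < k) _) (\sum_(i < j) _) (\sum_(i < l) _).
  move: (k%:R : R) (j%:R : R) (l%:R : R) (n%:R : R) (#|edges e|%:R : R).
  move=> K J L' N M Sk Sj Sl Vk Vl Bj conc kj' jl'.
  have h1 : (L' - J) * (M + K * (K + 1) / 2) < (L' - J) * Sk.
    by rewrite ltr_pM2l // subr_gt0.
  have h2 : (J - K) * (M + L' * (L' + 1) / 2) <= (J - K) * Sl.
    by apply: ler_wpM2l; rewrite ?subr_ge0 // ltW.
  have h3 : (L' - K) * Sj <= (L' - K) * (M + J * (J + 1) / 2 + N / 4).
    by apply: ler_wpM2l => //; rewrite subr_ge0 (le_trans kj') // ltW.
  have kl' : 0 < L' - K by rewrite subr_gt0 (le_lt_trans kj').
  (* The chord of [x (x + 1) / 2] from [K] to [L'] passes [(J - K) (L' - J) / 2] above its value at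
     [J]; the edge terms cancel. *)
  rewrite -(ltr_pM2l kl'); nra.
(* With [d = l - k], the two halves multiply to the floor of [d^2 / 4]; for odd [d] the rounding is
   recovered by integrality. *)
rewrite -!natrB ?(ltnW jl) // -!natrM ltr_nat /j; nia.
Qed.

End Violation.

(** * Passage to real powers and conclusion *)

Lemma powR_bounds (R : realType) (n d l : nat) :
  (0 < l)%N -> (l < n)%N -> (d < l)%N -> (d ^ 2 < 2 * n)%N ->
  d%:R < (2 * n%:R) `^ (1 / 4) * l%:R `^ (1 / 2) :> R
  /\ (2 * n%:R) `^ (1 / 4) * l%:R `^ (1 / 2)
     < 2 `^ (1 / 4) * n%:R `^ (3 / 4) :> R.
Proof.
move=> l0 ln dl dn; have n0 : (0 < n)%N by exact: leq_trans ln.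
split.
  have -> : (2 * n%:R) `^ (1 / 4) * l%:R `^ (1 / 2) =
      (2 * n%:R * l%:R ^+ 2) `^ (1 / 4) :> R.
    rewrite [RHS]powRM ?mulr_ge0 ?sqr_ge0 // -(powR_mulrn 2) // -powRrM.
    by congr (_ * _ `^ _); field.
  have -> : d%:R = (d%:R ^+ 4) `^ (1 / 4) :> R.
    rewrite -powR_mulrn // -powRrM.
    have -> : 4 * (1 / 4) = 1 :> R by field.
    by rewrite powRr1.
  apply: gt0_ltr_powR;
    rewrite ?nnegrE ?exprn_ge0 ?mulr_ge0 ?sqr_ge0 ?divr_gt0 //.
  (* The fourth power of the claim is the product of [d^2 < 2 n] and [d^2 < l^2]. *)
  have : (d ^ 4 < 2 * n * l ^ 2)%N.
    rewrite (expnD d 2 2).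
    case: d dl dn => [|d] dl dn; first by rewrite !expnS; nia.
    by apply: ltn_mul => //; rewrite ltn_sqr.
  by rewrite -(ltr_nat R) natrX [(2 * n * _)%:R]natrM natrX natrM.
(* Splitting [3/4] as [1/4 + 1/2] reduces the second inequality to [l < n]. *)
have -> : 2 `^ (1 / 4) * n%:R `^ (3 / 4) =
    (2 * n%:R) `^ (1 / 4) * n%:R `^ (1 / 2) :> R.
  rewrite [(2 * _) `^ _]powRM // -mulrA -powRD; last first.
    by rewrite pnatr_eq0 -lt0n n0 implybT.
  by congr (_ * _ `^ _); field.
rewrite ltr_pM2l ?powR_gt0 ?mulr_gt0 ?ltr0n //.
by apply: gt0_ltr_powR; rewrite ?nnegrE ?ltr_nat ?divr_gt0.
Qed.

Theorem theorem5p1 (R : realType) (T : finType) (e : rel T)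
    (e_sym : symmetric e) (e_irr : irreflexive e)
    (lam : #|T|.-tuple R)
    (lam_spec : ordered_spectrum (laplacian_mx R e) lam)
    (k l : nat) (hk : (1 <= k <= #|T|)%N) (hl : (1 <= l <= #|T|)%N)
    (sum_k : \sum_(i < k) lam`_i > #|edges e|%:R + 'C(k.+1, 2)%:R)
    (sum_l : \sum_(i < l) lam`_i > #|edges e|%:R + 'C(l.+1, 2)%:R) :
  `|l%:R - k%:R| < (2 * #|T|%:R) `^ (1 / 4) * (maxn k l)%:R `^ (1 / 2) :> R
  /\ (2 * #|T|%:R) `^ (1 / 4) * (maxn k l)%:R `^ (1 / 2)
     < 2 `^ (1 / 4) * #|T|%:R `^ (3 / 4) :> R.
Proof.
wlog kl : k l hk hl sum_k sum_l / (k <= l)%N => [wlog_kl|].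
  have [kl|lk] := orP (leq_total k l); first exact: wlog_kl.
  by rewrite maxnC distrC; exact: wlog_kl.
rewrite (maxn_idPr kl) -natrB // normr_nat.
have /andP[k1 _] := hk; have /andP[l1 lT] := hl.
(* Excluding [l = n] is what makes the second inequality strict. *)
have ln := violates_lt e_sym e_irr lam_spec hl sum_l.
apply: powR_bounds => //; first by rewrite ltn_subrL l1 andbT.
move: kl; rewrite leq_eqVlt => /predU1P[->|kl].
  by rewrite subnn muln_gt0 (leq_trans _ lT).
by apply: (violates_close e_sym e_irr lam_spec _ sum_k sum_l); rewrite kl.
Qed.
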